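(* Let $n\ge 5$, let $\lambda=(n-3,2,1)\vdash n$, and let $X=X_1\cup X_2$ be the union of two distinct conjugacy classes of $S_n$, with $x_1\in X_1$, $x_2\in X_2$. Then $rS_n=XS_\lambda$ for some positive integer $r$ if and only if, for some labelling $\{i,j\}=\{1,2\}$, the element $x_i$ has no fixed points, no $2$-cycles and no $3$-cycles, the element $x_j$ has exactly two fixed points, exactly one $2$-cycle and no $3$-cycles, and $|X_i|=|X_j|$.
   Context: For a partition $\lambda=(\lambda_1,\dots,\lambda_l)$ of $n$, the Young subgroup $S_\lambda=S_{\lambda_1}\times\dots\times S_{\lambda_l}\le S_n$ is the subgroup preserving each of the consecutive blocks of $\{1,\dots,n\}$ of sizes $\lambda_1,\dots,\lambda_l$. (The condition $n\ge5$ is exactly what is needed for $(n-3,2,1)$ to be a partition.) For a finite group $G$, subsets $A,B\subseteq G$ and a positive integer $r$, the notation $rG=AB$ (also written $A\cdot B=rG$) means that for every $g\in G$ there are exactly $r$ pairs $(a,b)\in A\times B$ with $ab=g$. *)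

(* Defs.v *)
From mathcomp Require Import all_boot all_fingroup.

Set Implicit Arguments.
Unset Strict Implicit.
Unset Printing Implicit Defensive.

Import GroupScope.

(* The k-th (counting from 0) of the consecutive blocks of 'I_n of sizes
   la_0, la_1, ...; points are numbered from 0. *)
Definition young_block (n : nat) (la : seq nat) (k : nat) : {set 'I_n} :=
  [set i : 'I_n | sumn (take k la) <= i < sumn (take k.+1 la)].

(* When la is a partition of n, the blocks partition 'I_n and this is the usual
   Young subgroup; 'N(A | 'P) is the setwise stabiliser of A. *)
Definition young_subgroup (n : nat) (la : seq nat) : {set 'S_n} :=
  \bigcap_(k < size la) 'N(young_block n la k | 'P).

Canonical young_subgroup_group (n : nat) (la : seq nat) :=
  Eval hnf in [group of young_subgroup n la].

(* r G = A B, with G the whole of gT *)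
Definition is_factorization (gT : finGroupType) (r : nat) (A B : {set gT}) :
    Prop :=
  forall g : gT,
    #|[set p : gT * gT | [&& p.1 \in A, p.2 \in B & p.1 * p.2 == g]]| = r.

Definition num_fixed (n : nat) (s : 'S_n) : nat := #|[set i | s i == i]|.

Definition num_cycles (k n : nat) (s : 'S_n) : nat :=
  #|[set c in porbits s | #|c| == k]|.

(* Main.v *)
Require Import Defs.
From mathcomp Require Import all_boot all_fingroup.
From mathcomp Require Import zify.

(** Identify a left coset of the Young subgroup with a flag ({a, b}, c) of
    distinct points. For a conjugation-invariant set [X], the factorization says
    that the number of elements of [X] carrying a flag to another one does not
    depend on the two flags.

    Write N(s -> t) for the number of elements of [X] carrying the word s, of
    distinct points, to the word t. By conjugation invariance, N(s -> t) depends
    only on how the letters of s and t coincide, and summing over one letter of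
    t deletes that letter from both words. These marginal relations express
    every N(s -> t) through the closed patterns, those in which t uses only
    letters of s ([words_determined]). The values on closed patterns are traces:
    N(s -> pi s) times the number of words s is the total number of occurrences
    of the pattern pi in the elements of [X] ([ncarry_trace]). So uniformity on
    flags amounts to five identities ([flag_uniform_traces]). If an element has
    a fixed points, b 2-cycles and c 3-cycles, they say that over [X] the means
    of a, a (a - 1) and 2 b are 1, and that the means of
    a (a - 1) (a - 2) + 2 a b and of 3 c + 2 a b are 2.

    For two classes of sizes m1, m2, the values of a are not both 1, because the
    mean of a (a - 1) is not 0. As the mean of a is 1, the smaller value is 0,
    and comparing the two means shows that the other is 2 and that m1 = m2. The
    remaining identities become linear and give b = 1 on the class with two
    fixed points, b = 0 on the other, and c = 0 on both
    ([pattern_equations]). *)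

Set Implicit Arguments.
Unset Strict Implicit.
Unset Printing Implicit Defensive.

Local Open Scope nat_scope.

(** * Counting the elements of a set that carry one word to another *)

(** Interchanging the first two letters: the words [:: a; b; c] and
    [:: b; a; c] encode the same flag ({a, b}, c). *)
Definition swap12 (T : Type) (t : seq T) : seq T :=
  if t is [:: a, b & u] then [:: b, a & u] else t.

Lemma swap12_map (T U : Type) (f : T -> U) t :
  swap12 (map f t) = map f (swap12 t).
Proof. by case: t => [|a [|b t]]. Qed.

Lemma ffact3 m : m ^_ 3 = m * (m - 1) * (m - 2).
Proof. by rewrite !ffactnSr ffactn0 mul1n subn0. Qed.

Section Words.
Variable T : finType.
Implicit Types (x sg : {perm T}) (X : {set {perm T}}) (s t : seq T).

Definition conj_closed X := forall x sg, ((x ^ sg)%g \in X) = (x \in X).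

Definition ncarry X s t : nat := \sum_(x in X) (map x s == t).

Lemma sum_notin t : uniq t -> \sum_(y : T) (y \notin t) = #|T| - size t.
Proof.
move=> ut; rewrite -big_mkcond sum1_card -(cardC (mem t)) (card_uniqP ut) addKn.
exact: eq_card.
Qed.

Lemma perm_extends s t :
  uniq s -> uniq t -> size s = size t -> exists sg : {perm T}, map sg s = t.
Proof.
elim: s t => [|a s IH] [|b t] //= /[swap]; first by exists 1%g.
move=> /andP[bt ut] /andP[as_ us] [] /(IH _ us ut)[sg Esg].
exists (sg * tperm (sg a) b)%g; rewrite permM tpermL; congr cons.
rewrite -[RHS]Esg; apply/eq_in_map => c cs; rewrite permM tpermD //.
  by rewrite (inj_eq perm_inj); apply: contraNneq as_ => ->.
by apply: contraNneq bt => ->; rewrite -Esg map_f.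
Qed.

Lemma map_conj x sg s : map (x ^ sg)%g (map sg s) = map sg (map x s).
Proof. by rewrite -!map_comp; apply: eq_map => a /=; rewrite permJ. Qed.

Lemma ncarry_map X sg s t :
  conj_closed X -> ncarry X (map sg s) (map sg t) = ncarry X s t.
Proof.
move=> Xc; rewrite /ncarry (reindex_inj (conjg_inj sg)); apply: eq_big => x.
  exact: Xc.
by rewrite map_conj (inj_eq (inj_map perm_inj)).
Qed.

Lemma ncarry_nonuniq X s t : uniq s -> ~~ uniq t -> ncarry X s t = 0.
Proof.
move=> us ut; apply: big1 => x _; apply/eqP; rewrite eqb0.
apply: contraNneq ut => <-; rewrite map_inj_uniq //; exact: perm_inj.
Qed.

Lemma ncarry_nil X : ncarry X [::] [::] = #|X|.
Proof. by rewrite /ncarry sum1_card. Qed.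

(** Every [x] sends the letter [a] to exactly one [y], so summing over [y]
    forgets that letter. *)
Lemma ncarry_marginal X s1 a s2 t1 t2 : size s1 = size t1 ->
  \sum_y ncarry X (s1 ++ a :: s2) (t1 ++ y :: t2)
  = ncarry X (s1 ++ s2) (t1 ++ t2).
Proof.
move=> e12; rewrite exchange_big; apply: eq_bigr => x _ /=.
rewrite (bigD1 (x a)) //= big1 => [|y /negPf yxa].
  by rewrite addn0 !map_cat !eqseq_cat ?size_map //= eqseq_cons eqxx.
by rewrite map_cat eqseq_cat ?size_map //= eqseq_cons [x a == y]eq_sym yxa andbF.
Qed.

Lemma ncarry_swap X a b c p q r :
  ncarry X [:: a; b; c] [:: p; q; r] = ncarry X [:: b; a; c] [:: q; p; r].
Proof. by apply: eq_bigr => x _; rewrite /= !eqseq_cons andbCA. Qed.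

Lemma ncarry_rot X a b c p q r :
  ncarry X [:: a; b; c] [:: p; q; r] = ncarry X [:: b; c; a] [:: q; r; p].
Proof.
by apply: eq_bigr => x _; rewrite /= !eqseq_cons eqxx !andbT andbC andbA.
Qed.

(** When [pi] is a rearrangement of letters, this counts the occurrences in [x]
    of a union of cycles: fixed points for [id], 2-cycles for [rev], 3-cycles
    for [rot 1], a 2-cycle together with a fixed point for [swap12]. *)
Definition npattern k (pi : seq T -> seq T) x : nat :=
  #|[set t : k.-tuple T | uniq t & map x t == pi t]|.

Lemma npattern_conj k pi x sg :
  (forall t, pi (map sg t) = map sg (pi t)) ->
  npattern k pi (x ^ sg)%g = npattern k pi x.
Proof.
move=> pim; rewrite /npattern -!sum1dep_card.
have inj : injective (map_tuple sg : k.-tuple T -> k.-tuple T).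
  by move=> t u /(congr1 val)/= /(inj_map perm_inj)/val_inj.
rewrite (reindex_inj inj); apply: eq_bigl => t /=.
rewrite (map_inj_uniq perm_inj).
by rewrite pim map_conj (inj_eq (inj_map perm_inj)).
Qed.

(** Double counting of the pairs made of an [x] in [X] and a word [s] that [x]
    carries to [pi s]. All words [s] contribute equally, because they are
    conjugate under the symmetric group and [pi] is natural. *)
Lemma ncarry_trace X k pi s : conj_closed X ->
  (forall sg t, pi (map sg t) = map sg (pi t)) -> uniq s -> size s = k ->
  ncarry X s (pi s) * #|T| ^_ k = \sum_(x in X) npattern k pi x.
Proof.
move=> Xc pim us sk; under eq_bigr do rewrite /npattern -sum1dep_card big_mkcondr.
rewrite exchange_big /=.
rewrite (eq_bigr (fun=> ncarry X s (pi s))) => [|t ut]; last first.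
  have [|sg <-] := perm_extends us ut; first by rewrite size_tuple.
  rewrite pim -[RHS](ncarry_map sg) //; apply: eq_bigr => x _.
rewrite sum_nat_const mulnC; congr (_ * _).
rewrite -(card_uniq_tuples k T); apply: eq_card => t.
by rewrite !inE unfold_in; have -> : all T t by apply/allP.
Qed.

Definition equidistributed X k := forall s t, uniq s -> uniq t ->
  size s = k -> size t = k -> ncarry X s t * #|T| ^_ k = #|X|.

(** Induction on the number of letters of [t] outside [P]. Pick such a letter
    and sum [f] over all the values that may replace it: the values in [P] are
    handled by induction, those already present give a repetition, and all the
    others give the same value as [t] itself, because permutations fixing [P]
    pointwise exchange them. So the marginal determines [f t]. *)
Lemma words_determined (f g : seq T -> nat) (P : pred T) k :
  (forall sg, {in P, sg =1 id} -> forall t, f (map sg t) = f t) ->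
  (forall sg, {in P, sg =1 id} -> forall t, g (map sg t) = g t) ->
  (forall t, ~~ uniq t -> f t = g t) ->
  (forall t, uniq t -> size t = k.+1 -> all P t -> f t = g t) ->
  (forall t1 t2, size t1 + size t2 = k ->
     \sum_y f (t1 ++ y :: t2) = \sum_y g (t1 ++ y :: t2)) ->
  forall t, size t = k.+1 -> f t = g t.
Proof.
move=> fP gP fgN fgP fgS t; have [m] := ubnP (count (predC P) t).
elim: m t => // m IH t ltm tk.
have [ut|] := boolP (uniq t); last exact: fgN.
have [|/allPn[z zt zP]] := boolP (all P t); first exact: fgP.
case/splitPr: zt tk ltm ut => t1 t2 tk ltm ut.
have zN : z \notin t1 ++ t2.
  by move: ut; rewrite uniq_catC cons_uniq mem_cat orbC -mem_cat => /andP[].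
have t12 : size t1 + size t2 = k by move: tk; rewrite size_cat addnS => -[].
pose Q y := ~~ P y && (y \notin t1 ++ t2).
have const h : (forall sg, {in P, sg =1 id} -> forall t, h (map sg t) = h t) ->
    \sum_(y | Q y) h (t1 ++ y :: t2) = #|Q| * h (t1 ++ z :: t2).
  move=> hP; rewrite -sum_nat_const; apply: eq_bigr => y /andP[yP yN].
  have fixt c : c \in t1 ++ t2 -> tperm y z c = c.
    move=> ct; rewrite tpermD //; first by apply: contraNneq yN => ->.
    by apply: contraNneq zN => ->.
  rewrite -(hP (tperm y z) _ (t1 ++ y :: t2)) => [|c cP].
    rewrite map_cat /= tpermL; congr (h (_ ++ _ :: _));
    by apply: map_id_in => c ct; apply: fixt; rewrite mem_cat ct ?orbT.
  rewrite tpermD //; first by apply: contraNneq yP => ->.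
  by apply: contraNneq zP => ->.
have := fgS _ _ t12; rewrite (bigID Q) [RHS](bigID Q) /= (const f) // (const g) //.
rewrite (eq_bigr (fun y => g (t1 ++ y :: t2))) => [/addIn/eqP|y]; last first.
  rewrite negb_and !negbK => /orP[yP|yt]; last first.
    by apply: fgN; rewrite uniq_catC cons_uniq mem_cat orbC -mem_cat yt.
  apply: IH; last by rewrite -tk !size_cat.
  by move: ltm; rewrite !count_cat /= zP yP /= !addnS.
rewrite eqn_pmul2l => [/eqP//|]; apply/card_gt0P; exists z.
by rewrite unfold_in /Q zP.
Qed.

(** The uniform value has the same marginals as the counts, as soon as the
    counts for words one letter shorter are known to be uniform. Hence
    uniformity need only be tested on words in the letters of the sources.
    Several sources are allowed, so that the two words encoding a flag can be
    treated together. *)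
Lemma ncarry_determined X k (S : seq (seq T)) (P : pred T) :
  conj_closed X -> equidistributed X k ->
  {in S, forall s, [/\ uniq s, size s = k.+1 & all P s]} ->
  (forall t, uniq t -> size t = k.+1 -> all P t ->
     (\sum_(s <- S) ncarry X s t) * #|T| ^_ k.+1 = size S * #|X|) ->
  forall t, uniq t -> size t = k.+1 ->
     (\sum_(s <- S) ncarry X s t) * #|T| ^_ k.+1 = size S * #|X|.
Proof.
move=> Xc Xk SP SX t ut tk.
pose f t := (\sum_(s <- S) ncarry X s t) * #|T| ^_ k.+1.
pose g t := uniq t * (size S * #|X|).
suff: f t = g t by rewrite /f /g ut mul1n.
apply: (words_determined (P := P) (k := k)) tk => {t ut}.
- move=> sg sgP t; congr (_ * _); rewrite !big_seq; apply: eq_bigr => s /SP[_ _ sP].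
  rewrite -(ncarry_map sg s t) //; congr ncarry; symmetry; apply: map_id_in => a.
  by move/(allP sP)/sgP.
- by move=> sg _ t; rewrite /g (map_inj_uniq perm_inj).
- move=> t ut; rewrite /f /g (negPf ut) big_seq big1 // => s /SP[us _ _].
  exact: ncarry_nonuniq.
- by move=> t ut tk tP; rewrite /g ut mul1n; apply: SX.
move=> t1 t2 t12; rewrite -big_distrl -big_distrl /= exchange_big /=.
have Ef : {in S, forall s, (\sum_y ncarry X s (t1 ++ y :: t2)) * #|T| ^_ k.+1 =
           uniq (t1 ++ t2) * #|X| * (#|T| - k)}.
  move=> s /SP[us sk _].
  have t1s : size t1 < size s by rewrite sk -t12 ltnS leq_addr.
  case: s us sk t1s => // a0 s'; set s := _ :: s' => us sk t1s.
  rewrite -[s](cat_take_drop (size t1)) (drop_nth a0) //.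
  rewrite ncarry_marginal ?size_takel 1?ltnW // ffactnSr mulnA; congr (_ * _).
  have us' : uniq (take (size t1) s ++ drop (size t1).+1 s).
    move: us; rewrite -[s in uniq s](cat_take_drop (size t1)) (drop_nth a0) //.
    by rewrite !(uniq_catC (take _ _)) cons_uniq => /andP[].
  case: (boolP (uniq _)) => ut; last by rewrite ncarry_nonuniq.
  rewrite mul1n; apply: Xk => //; last by rewrite size_cat.
  rewrite size_cat size_drop size_takel; last exact: ltnW.
  by rewrite sk subSS -t12 addKn.
rewrite big_distrl /= big_seq (eq_bigr _ Ef) -big_seq big_const_seq iter_addn_0.
rewrite count_predT.
have -> : \sum_y uniq (t1 ++ y :: t2) = uniq (t1 ++ t2) * (#|T| - k).
  under eq_bigr do rewrite uniq_catC cons_uniq mem_cat orbC -mem_cat uniq_catC.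
  case: (boolP (uniq _)) => ut; last by rewrite big1 // => y _; rewrite andbF.
  by under eq_bigr do rewrite andbT; rewrite mul1n sum_notin // size_cat t12.
by rewrite (mulnAC _ #|X|) -mulnA (mulnC #|X|).
Qed.

(** * Uniformity on flags *)

Definition flag_carry X s t := ncarry X s t + ncarry X (swap12 s) t.

Definition flag_uniform X r := forall s t,
  uniq s -> uniq t -> size s = 3 -> size t = 3 -> flag_carry X s t = r.

(** Summing [flag_carry] over the first letter of the target shows that
    N(ac -> pq) + N(bc -> pq) does not depend on the distinct sources a, b, c.
    Two spare points b, b' give three such equations between three unknowns,
    which forces the unknowns to be equal; this is where four points are
    used. *)
Lemma flag_uniform_pairs X r a c p q : 4 <= #|T| -> flag_uniform X r ->
  a != c -> p != q -> 2 * ncarry X [:: a; c] [:: p; q] = r * (#|T| - 2).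
Proof.
move=> T4 Xr ac pq.
have pair b d e : uniq [:: b; d; e] ->
    ncarry X [:: d; e] [:: p; q] + ncarry X [:: b; e] [:: p; q] = r * (#|T| - 2).
  move=> ub; have upq : uniq [:: p; q] by rewrite /= inE pq.
  rewrite -(@ncarry_marginal X [::] b [:: d; e] [::]) //.
  rewrite -(@ncarry_marginal X [::] d [:: b; e] [::]) // -big_split /=.
  rewrite -(sum_notin upq) big_distrr /=; apply: eq_bigr => y _.
  have [yN|/negPn yN] := boolP (y \notin [:: p; q]).
    by rewrite muln1; apply: Xr => //; rewrite cons_uniq yN.
  rewrite muln0 !ncarry_nonuniq ?cons_uniq ?yN //=.
  by move: ub; rewrite /= !inE !negb_or eq_sym => /and3P[/andP[-> ->] ->].
have /card_gt1P[b [b' []]] : 1 < #|~: [set a; c]|.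
  by rewrite cardsCs setCK cards2 ac; lia.
rewrite !inE !negb_or => /andP[ba bc] /andP[b'a b'c] bb'.
have := pair b a c; have := pair b' a c; have := pair b b' c.
by rewrite /= !inE !negb_or ba bc b'a b'c bb' ac /=; lia.
Qed.

Lemma flag_uniform_point X r a p : 4 <= #|T| -> flag_uniform X r ->
  2 * ncarry X [:: a] [:: p] = r * (#|T| - 2) * (#|T| - 1).
Proof.
move=> T4 Xr; have /card_gt0P[b] : 0 < #|~: [set a]|.
  by rewrite cardsCs setCK cards1; lia.
rewrite !inE eq_sym => ab.
rewrite -(@ncarry_marginal X [:: a] b [::] [:: p] [::]) // big_distrr /=.
rewrite -(@sum_notin [:: p]) // big_distrr; apply: eq_bigr => y _ /=.
rewrite inE eq_sym; have [->|py] := eqVneq p y; last first.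
  by rewrite muln1 (flag_uniform_pairs T4 Xr).
by rewrite muln0 ncarry_nonuniq //= !inE ?ab ?eqxx.
Qed.

Lemma flag_uniform_card X r : 4 <= #|T| -> flag_uniform X r ->
  r * #|T| ^_ 3 = 2 * #|X|.
Proof.
move=> T4 Xr; have /card_gt0P[a _] : 0 < #|T| by lia.
rewrite -ncarry_nil -(@ncarry_marginal X [::] a [::] [::] [::]) // big_distrr /=.
under eq_bigr do rewrite (flag_uniform_point _ _ T4 Xr).
rewrite sum_nat_const ffact3 -[X in _ = X * _]/#|T|; move: #|T| => m.
by rewrite -!mulnA mulnCA [(m - 1) * _]mulnC.
Qed.

(** Uniformity is propagated from words of length 0 to 1, 2 and then to flags,
    each time from the closed patterns by [ncarry_determined]. For a flag on
    {a, b, c}, every one of the six targets with the same letters pairs one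
    count of type [swap12] with one of type [id] or [rot 1]; these are the
    constants [e2], [e1] and [e3]. *)
Lemma flag_carry_from_patterns X e1 e2 e3 : conj_closed X ->
    (forall a, ncarry X [:: a] [:: a] * #|T| ^_ 1 = #|X|) ->
    (forall a b, a != b -> ncarry X [:: a; b] [:: a; b] * #|T| ^_ 2 = #|X|) ->
    (forall a b, a != b -> ncarry X [:: a; b] [:: b; a] * #|T| ^_ 2 = #|X|) ->
    (forall a b c, uniq [:: a; b; c] ->
       [/\ ncarry X [:: a; b; c] [:: a; b; c] = e1,
           ncarry X [:: a; b; c] [:: b; a; c] = e2
         & ncarry X [:: a; b; c] [:: b; c; a] = e3]) ->
    (e1 + e2) * #|T| ^_ 3 = 2 * #|X| ->
    (e3 + e2) * #|T| ^_ 3 = 2 * #|X| ->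
  forall s t, uniq s -> uniq t -> size s = 3 -> size t = 3 ->
    flag_carry X s t * #|T| ^_ 3 = 2 * #|X|.
Proof.
move=> Xc X1 X2id X2rev X3 e12 e32.
have X0 : equidistributed X 0.
  by move=> [|//] [|//] _ _ _ _; rewrite ncarry_nil ffactn0 muln1.
have eq1 : equidistributed X 1.
  move=> [//|a [|//]] t _ ut _ t1.
  have: (\sum_(s <- [:: [:: a]]) ncarry X s t) * #|T| ^_ 1 = 1 * #|X|.
    2: by rewrite big_seq1 mul1n.
  apply: (ncarry_determined (P := pred1 a) Xc X0) t ut t1.
    by move=> s; rewrite inE => /eqP-> /=; rewrite eqxx.
  move=> [//|b [|//]] _ _; rewrite big_seq1 [size _]/= mul1n /= andbT => /eqP->.
  exact: X1.
have eq2 : equidistributed X 2.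
  move=> [//|a [//|b [|//]]] t us ut _ t2.
  have: (\sum_(s <- [:: [:: a; b]]) ncarry X s t) * #|T| ^_ 2 = 1 * #|X|.
    2: by rewrite big_seq1 mul1n.
  apply: (ncarry_determined (P := mem [:: a; b]) Xc eq1) t ut t2.
    by move=> s; rewrite inE => /eqP->; split=> //=; rewrite !inE !eqxx orbT.
  move: us => /=; rewrite inE andbT => ab.
  move=> [//|p [//|q [|//]]] ut _; rewrite big_seq1 mul1n /= !inE andbT.
  case/andP=> /orP[]/eqP Ep /orP[]/eqP Eq; move: ut;
    rewrite {}Ep {}Eq /= inE ?eqxx // => _.
    exact: X2id.
  exact: X2rev.
move=> [//|a [//|b [//|c [|//]]]] t us ut _ t3.
have: (\sum_(s <- [:: [:: a; b; c]; [:: b; a; c]]) ncarry X s t) * #|T| ^_ 3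
      = 2 * #|X|.
  2: by rewrite big_cons big_seq1.
apply: (ncarry_determined (P := mem [:: a; b; c]) Xc eq2) t ut t3.
  move=> s; rewrite !inE => /orP[]/eqP->; split=> //=; rewrite !inE ?eqxx ?orbT //.
  by move: us; rewrite /= !inE !negb_or eq_sym => /and3P[/andP[-> ->] ->].
move=> t ut; rewrite big_cons big_seq1.
have [ab ac bc] : [/\ a != b, a != c & b != c].
  by move: us; rewrite /= !inE !negb_or => /and3P[/andP[-> ->] ->].
have u (x y z : T) : x != y -> x != z -> y != z -> uniq [:: x; y; z].
  by move=> xy xz yz; rewrite /= !inE negb_or xy xz yz.
have [ba ca cb] : [/\ b != a, c != a & c != b].
  by rewrite ![_ == a]eq_sym [c == _]eq_sym.
case: t ut => [//|p [//|q [//|r [|//]]]] ut _; rewrite /= !inE andbT.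
case/and3P=> /or3P[]/eqP Ep /or3P[]/eqP Eq /or3P[]/eqP Er;
  move: ut; rewrite {}Ep {}Eq {}Er /= !inE ?eqxx ?orbT /= ?andbF //= => _.
(* The six targets, in lexicographic order from abc to cba. *)
- by have [-> e2E _] := X3 a b c (u a b c ab ac bc); rewrite ncarry_swap e2E.
- have [_ _ ->] := X3 b a c (u b a c ba bc ac).
  by have [_ e2E _] := X3 b c a (u b c a bc ba ca); rewrite ncarry_rot e2E addnC.
- have [_ -> _] := X3 a b c (u a b c ab ac bc).
  by have [-> _ _] := X3 b a c (u b a c ba bc ac); rewrite addnC.
- have [_ _ ->] := X3 a b c (u a b c ab ac bc).
  by have [_ e2E _] := X3 a c b (u a c b ac ab cb); rewrite ncarry_rot e2E.
- have [_ _ e3E] := X3 b a c (u b a c ba bc ac).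
  have [_ e2E _] := X3 c b a (u c b a cb ca ba).
  by rewrite ncarry_swap e3E ncarry_rot ncarry_rot e2E.
have [_ _ e3E] := X3 a b c (u a b c ab ac bc).
have [_ e2E _] := X3 c a b (u c a b ca cb ab).
by rewrite ncarry_rot ncarry_rot e2E ncarry_swap e3E addnC.
Qed.

(** The average number of occurrences of each closed pattern detects uniformity
    on flags. In terms of characters: the permutation module on flags of type
    (n-3, 2, 1) has five nontrivial constituents in general, and the five
    identities say that the class sum of [X] acts on them by zero. *)
Theorem flag_uniform_traces X : 4 <= #|T| -> conj_closed X ->
  (exists r, flag_uniform X r) <->
  [/\ \sum_(x in X) npattern 1 id x = #|X|,
      \sum_(x in X) npattern 2 id x = #|X|,
      \sum_(x in X) npattern 2 rev x = #|X|,
      \sum_(x in X) npattern 3 id x + \sum_(x in X) npattern 3 (@swap12 T) x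
        = 2 * #|X|
    & \sum_(x in X) npattern 3 (rot 1) x + \sum_(x in X) npattern 3 (@swap12 T) x
        = 2 * #|X|].
Proof.
move=> T4 Xc.
have trid k s (us : uniq s) (sk : size s = k) :=
  ncarry_trace (pi := id) Xc (fun _ _ => erefl) us sk.
have trrev k s (us : uniq s) (sk : size s = k) :=
  ncarry_trace Xc (fun (sg : {perm T}) t => esym (map_rev sg t)) us sk.
have trrot k s (us : uniq s) (sk : size s = k) :=
  ncarry_trace Xc (fun (sg : {perm T}) t => esym (map_rot _ _ _)) us sk.
have trswap k s (us : uniq s) (sk : size s = k) :=
  ncarry_trace Xc (fun (sg : {perm T}) t => swap12_map sg t) us sk.
have [s us s3] : exists2 s : seq T, uniq s & size s = 3.
  exists (take 3 (enum T)); first by rewrite take_uniq ?enum_uniq.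
  by rewrite size_takel // -cardE ltnW.
case: s us s3 => [//|a [//|b [//|c [|//]]]] us _.
have ab : a != b by move: us; rewrite /= !inE negb_or => /andP[/andP[->]].
have ucb : uniq [:: a; c; b].
  move: us; rewrite /= !inE !negb_or => /and3P[/andP[-> ->]].
  by rewrite eq_sym => ->.
have uab : uniq [:: a; b] by rewrite /= inE ab.
have n3 : 0 < #|T| ^_ 3 by rewrite ffact_gt0 ltnW.
have ffact32 : #|T| ^_ 3 = #|T| ^_ 2 * (#|T| - 2) by rewrite ffactnSr.
split=> [[r Xr]|[E1 E2id E2rev E3 E3rot]].
  have rn := flag_uniform_card T4 Xr.
  have pairs p q : p != q -> ncarry X [:: a; b] [:: p; q] * #|T| ^_ 2 = #|X|.
    move=> pq; apply/eqP; rewrite -(@eqn_pmul2l 2) // mulnA.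
    rewrite (flag_uniform_pairs T4 Xr) // -rn ffact32; apply/eqP.
    by rewrite -mulnA; congr (_ * _); rewrite mulnC.
  split.
  - rewrite -(trid 1 [:: a]) //; apply/eqP; rewrite -(@eqn_pmul2l 2) // mulnA.
    rewrite (flag_uniform_point _ _ T4 Xr) -rn ffact3 ffactn1; apply/eqP.
    by rewrite -!mulnA; congr (_ * _); rewrite mulnC [_ * #|T|]mulnC -mulnA.
  - by rewrite -(trid 2 [:: a; b]) // pairs.
  - by rewrite -(trrev 2 [:: a; b]) // pairs // eq_sym.
  - rewrite -(trid 3 _ us) // -(trswap 3 _ us) // -mulnDl -rn; congr (_ * _).
    by rewrite -(Xr [:: a; b; c] [:: a; b; c]) // /flag_carry (ncarry_swap X b).
  (* In flag_carry abc bca, the count N(bac -> bca) is N(acb -> cab), which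
     interchanges a and c and fixes b. *)
  rewrite -(trrot 1 3 _ us) // -(trswap 3 [:: a; c; b]) // -mulnDl -rn.
    congr (_ * _); rewrite -(Xr [:: a; b; c] [:: b; c; a]) //.
      by rewrite /flag_carry (ncarry_rot X b).
    by rewrite (rot_uniq 1 [:: a; b; c]).
have const (pi : seq T -> seq T) s t :
    uniq s -> uniq t -> size s = 3 -> size t = 3 ->
    (forall (sg : {perm T}) t, pi (map sg t) = map sg (pi t)) ->
    ncarry X s (pi s) = ncarry X t (pi t).
  move=> us' ut s3 t3 pim; apply/eqP; rewrite -(eqn_pmul2r n3).
  by rewrite !(ncarry_trace Xc pim).
have flagE s t : uniq s -> uniq t -> size s = 3 -> size t = 3 ->
    flag_carry X s t * #|T| ^_ 3 = 2 * #|X|.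
  apply: (flag_carry_from_patterns (e1 := ncarry X [:: a; b; c] [:: a; b; c])
    (e2 := ncarry X [:: a; b; c] [:: b; a; c])
    (e3 := ncarry X [:: a; b; c] [:: b; c; a])) => //.
  - by move=> d; rewrite -E1 -(trid 1 [:: d]).
  - by move=> d e de; rewrite -E2id -(trid 2 [:: d; e]) //= inE de.
  - by move=> d e de; rewrite -E2rev -(trrev 2 [:: d; e]) //= inE de.
  - move=> d e f u; split.
    + exact: (const id).
    + apply: (const (@swap12 T) [:: d; e; f] [:: a; b; c]) => // *.
      exact: swap12_map.
    apply: (const (rot 1) [:: d; e; f] [:: a; b; c]) => // *.
    by rewrite map_rot.
  - by rewrite mulnDl (trid 3 _ us) // (trswap 3 _ us).
  by rewrite mulnDl (trrot 1 3 _ us) // (trswap 3 _ us).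
exists (flag_carry X [:: a; b; c] [:: a; b; c]) => s t us' ut s3 t3.
by apply/eqP; rewrite -(eqn_pmul2r n3) !flagE.
Qed.

End Words.

(** * Cycle type and closed patterns *)

(** The points lying on k-cycles are partitioned by these cycles. *)
Lemma card_porbit_size n (x : 'S_n) k :
  #|[set i | #|porbit x i| == k]| = num_cycles k x * k.
Proof.
set D := [set i | _]; set P := [set c in porbits x | #|c| == k].
have PD : P = porbit x @: D.
  apply/setP=> c; rewrite inE; apply/andP/imsetP=> [[/imsetP[i _ ->] ik]|[i]].
    by exists i; rewrite // inE.
  by rewrite inE => ik ->; rewrite imset_f.
apply: card_uniform_partition => [c|]; first by rewrite inE => /andP[_ /eqP].
suff -> : [set c in porbits x | #|c| == k]
    = equivalence_partition (fun i j => j \in porbit x i) D.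
  apply: equivalence_partitionP => i j l _ _ _; rewrite porbit_id; split=> // ij.
  by move: ij; rewrite porbit_sym -eq_porbit_mem => /eqP->.
rewrite -/P PD; apply: eq_in_imset => i; rewrite inE => ik; apply/setP=> j.
rewrite !inE andb_idl // porbit_sym -eq_porbit_mem => /eqP<- //.
Qed.

Lemma porbit2P n (x : 'S_n) i : (#|porbit x i| == 2) = (x i != i) && (x (x i) == i).
Proof.
apply/eqP/andP=> [i2|[xi /eqP xxi]].
  have := uniq_traject_porbit x i; have := iter_porbit x i.
  by rewrite i2 /= => -> ; rewrite inE andbT eq_sym.
have -> : porbit x i = [set i; x i].
  apply/setP=> j; rewrite !inE; apply/porbitP/orP=> [[m ->]|[/eqP->|/eqP->]].
  - elim: m => [|m]; first by rewrite expg0 perm1 eqxx; left.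
    by rewrite expgSr permM => -[] /eqP ->; rewrite ?xxi eqxx; [right|left].
  - by exists 0; rewrite expg0 perm1.
  by exists 1; rewrite expg1.
by rewrite cards2 eq_sym xi.
Qed.

Lemma porbit3P n (x : 'S_n) i :
  (#|porbit x i| == 3) = (x i != i) && (x (x (x i)) == i).
Proof.
apply/eqP/andP=> [i3|[xi /eqP xxi]].
  have := uniq_traject_porbit x i; have := iter_porbit x i.
  by rewrite i3 /= => -> ; rewrite !inE negb_or eq_sym eqxx => /andP[/andP[]].
have -> : porbit x i = [set i; x i; x (x i)].
  apply/setP=> j; rewrite !inE -orbA; apply/porbitP/or3P=> [[m ->]|[]/eqP->].
  - elim: m => [|m]; first by rewrite expg0 perm1 eqxx; constructor 1.
    rewrite expgSr permM => -[] /eqP ->; rewrite ?xxi eqxx;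
    by [constructor 2|constructor 3|constructor 1].
  - by exists 0; rewrite expg0 perm1.
  - by exists 1; rewrite expg1.
  by exists 2; rewrite expgSr expg1 permM.
rewrite setUC cardsU1 cards2 !inE (inj_eq perm_inj) [i == _]eq_sym xi.
suff /negPf-> : x (x i) != i by rewrite xi.
by apply: contraNneq xi => xx; rewrite -{2}xxi xx.
Qed.

Section Patterns.
Variables (n : nat) (x : 'S_n).

Lemma npattern_id k : npattern k id x = num_fixed x ^_ k.
Proof.
rewrite /num_fixed cardsE -card_uniq_tuples; apply: eq_card => t.
rewrite !inE andbC; congr (_ && _).
rewrite -[X in _ == X]map_id; apply/eqP/allP=> [/eq_in_map xt i /xt|xt].
  by move=> /= ->; apply: eqxx.
by apply/eq_in_map=> i /xt /= /eqnP xi; apply: val_inj.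
Qed.

Lemma npattern_rev : npattern 2 rev x = (num_cycles 2 x).*2.
Proof.
rewrite -muln2 -card_porbit_size -(card_imset _ (f := fun i => [tuple i; x i])).
  apply: eq_card => t; rewrite inE; apply/andP/imsetP.
    case: t => -[|a [|b [|c t]]] //= s2; rewrite /rev /= inE andbT.
    move=> [ab /eqP[xab xba]]; exists a; last by apply: val_inj; rewrite /= xab.
    by rewrite inE porbit2P xab xba eqxx eq_sym ab.
  case=> i; rewrite inE porbit2P eq_sym => /andP[xi /eqP xxi] -> /=.
  by rewrite inE xi xxi.
by move=> i j /(congr1 val)[].
Qed.

Lemma npattern_rot : npattern 3 (rot 1) x = num_cycles 3 x * 3.
Proof.
rewrite -card_porbit_size -(card_imset _ (f := fun i => [tuple i; x i; x (x i)])).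
  apply: eq_card => t; rewrite inE; apply/andP/imsetP.
    case: t => -[|a [|b [|c [|d t]]]] //= s3; rewrite /rot /= !inE negb_or andbT.
    move=> [/andP[/andP[ab ac] bc] /eqP[xab xbc xca]].
    exists a; last by apply: val_inj; rewrite /= xab xbc.
    by rewrite inE porbit3P xab xbc xca eqxx eq_sym ab.
  case=> i; rewrite inE porbit3P eq_sym => /andP[xi /eqP xxi] -> /=.
  rewrite /rot /= !inE negb_or !(inj_eq perm_inj) xi xxi andbT; split=> //.
  by rewrite andbT /=; apply: contraNneq xi => xx; rewrite -{1}xxi -xx.
by move=> i j /(congr1 val)[].
Qed.

Lemma npattern_swap : npattern 3 (@swap12 _) x = (num_cycles 2 x).*2 * num_fixed x.
Proof.
rewrite -muln2 -card_porbit_size -cardsX.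
rewrite -(card_imset _ (f := fun p => [tuple p.1; x p.1; p.2])).
  apply: eq_card => t; rewrite inE; apply/andP/imsetP.
    case: t => -[|a [|b [|c [|d t]]]] //= s3; rewrite !inE negb_or andbT.
    move=> [/andP[/andP[ab ac] bc] /eqP[xab xba xc]].
    exists (a, c); last by apply: val_inj; rewrite /= xab.
    by rewrite !inE porbit2P /= xab xba xc !eqxx eq_sym ab.
  case=> -[i c]; rewrite !inE porbit2P eq_sym /=.
  move=> /andP[/andP[xi /eqP xxi] /eqP xc] -> /=.
  rewrite !inE negb_or -{2}xc (inj_eq perm_inj) xi xxi xc eqxx andbT /=; split=> //.
  by rewrite andbb; apply: contraNneq xi => ->; rewrite xc.
by move=> [i c] [j d] /(congr1 val)[-> _ ->].
Qed.

End Patterns.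

(** * Young subgroups as flag stabilisers *)

(** The last three points form a flag; stabilising its pair and its point
    stabilises also the complement, which is the first block. *)
Lemma young_subgroup_flag n : 3 <= n -> exists s0 : seq 'I_n,
  [/\ uniq s0, size s0 = 3 & forall h : 'S_n,
   (h \in young_subgroup n [:: n - 3; 2; 1]) = (map h s0 \in [:: s0; swap12 s0])].
Proof.
move=> n3; have [a3 b2 c1] : [/\ n - 3 < n, n - 2 < n & n - 1 < n] by split; lia.
pose a := Ordinal a3; pose b := Ordinal b2; pose c := Ordinal c1.
have [ab ac bc] : [/\ a != b, a != c & b != c].
  by rewrite -!val_eqE /=; split; lia.
exists [:: a; b; c]; split=> // [|h]; first by rewrite /= !inE negb_or ab ac bc.
set la := [:: _; _; _].
have B1 : young_block n la 1 = [set a; b].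
  by apply/setP=> i; have := ltn_ord i; rewrite !inE -!val_eqE /=; lia.
have B2 : young_block n la 2 = [set c].
  by apply/setP=> i; have := ltn_ord i; rewrite !inE -!val_eqE /=; lia.
have B0 : young_block n la 0 = ~: ([set a; b] :|: [set c]).
  by apply/setP=> i; have := ltn_ord i; rewrite !inE -!val_eqE /=; lia.
rewrite /young_subgroup !big_ord_recl big_ord0 setIT /= B0 B1 B2 astabsC.
apply/idP/idP=> [|hs].
  case/setIP=> _ /setIP[h1 h2].
  have := astabs_act a h1; have := astabs_act b h1; have := astabs_act c h2.
  rewrite !inE /= !apermE !eqxx ?orbT => /eqP hc /orP[]/eqP hb /orP[]/eqP ha;
    rewrite ha hb hc ?eqxx ?orbT //.
  - by move: ab; rewrite -(inj_eq (@perm_inj _ h)) ha hb eqxx.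
  by move: ab; rewrite -(inj_eq (@perm_inj _ h)) ha hb eqxx.
have [hab hc] : h @: [set a; b] = [set a; b] /\ h c = c.
  move: hs; rewrite !inE /= => /orP[]/eqP[ha hb hc]; split=> //;
  by rewrite imsetU1 imset_set1 ha hb // setUC.
have N1 : h \in ('N([set a; b] | 'P))%g.
  by rewrite !inE; apply/subsetP=> i iab; rewrite inE /= apermE -hab imset_f.
have N2 : h \in ('N([set c] | 'P))%g.
  by rewrite !inE; apply/subsetP=> i; rewrite !inE /= apermE => /eqP->; rewrite hc.
apply/setIP; split; last by apply/setIP.
by apply: (subsetP (astabsU _ _ _)); apply/setIP.
Qed.

(** The pairs (a, h) with a h = g are indexed by the a in X such that a^-1 g
    stabilises the base flag, that is, such that a carries g^-1 (base flag) to
    the base flag. Any two flags can be brought to this form by conjugation. *)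
Lemma factorization_flag_uniform n (X : {set 'S_n}) r : 3 <= n ->
  conj_closed X ->
  is_factorization r X (young_subgroup n [:: n - 3; 2; 1]) <-> flag_uniform X r.
Proof.
move=> n3 Xc; set H := young_subgroup _ _.
have [s0 [us0 s03 Hs0]] := young_subgroup_flag n3.
have carryE (g : 'S_n) :
    #|[set p : 'S_n * 'S_n | [&& p.1 \in X, p.2 \in H & (p.1 * p.2 == g)%g]]|
    = flag_carry X (map g^-1%g s0) s0.
  pose f (a : 'S_n) := (a, (a^-1 * g)%g); have f_inj : injective f by move=> a b [].
  transitivity #|f @: [set a in X | (a^-1 * g)%g \in H]|.
    apply: eq_card => -[a h]; rewrite inE /=.
    apply/and3P/imsetP=> [[aX hH /eqP gE]|].
      by exists a; rewrite /f -gE ?inE mulKg ?aX.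
    by case=> b; rewrite inE => /andP[bX bH] [-> ->]; rewrite mulKVg.
  rewrite card_imset // -sum1dep_card big_mkcondr /flag_carry -big_split /=.
  apply: eq_bigr => a _; rewrite Hs0 !inE swap12_map.
  have moveg u : (map (a^-1 * g)%g s0 == u) = (map a (map g^-1%g u) == s0).
    by apply/eqP/eqP=> <-; rewrite -!map_comp -[RHS]map_id; apply: eq_map => i;
      rewrite /= permM ?permK ?permKV.
  rewrite !moveg -!swap12_map; have [->|_] /= := eqVneq _ s0; last by case: eqP.
  suff /negPf-> : swap12 s0 != s0 by [].
  case: s0 us0 s03 {Hs0 moveg} => [//|b [//|c s0]] us0 _ /=; rewrite eqseq_cons.
  by move: us0; rewrite /= inE negb_or eq_sym => /andP[/andP[/negPf->]].
split=> Xr.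
  move=> s t us ut s3 t3.
  have [|sg sgt] := perm_extends ut us0; first by rewrite t3.
  have [||tau taus] := perm_extends us0 (t := map sg s).
  - by rewrite (map_inj_uniq perm_inj).
  - by rewrite size_map s03 s3.
  rewrite -(Xr tau^-1%g) carryE invgK taus /flag_carry swap12_map -sgt.
  by rewrite !ncarry_map.
move=> g; rewrite carryE; apply: Xr; rewrite ?size_map //.
by rewrite (map_inj_uniq perm_inj).
Qed.

(** * Solving for two classes *)

(** The equations when the first class has no fixed points. The first two give
    m2 a2 (a2 - 1) = m2 a2, hence a2 = 2 and m1 = m2; the others are then
    linear. *)
Lemma pattern_equations_half m1 m2 a2 b1 b2 c1 c2 : 0 < m1 -> 0 < m2 ->
  m2 * a2 = m1 + m2 ->
  m2 * a2 ^_ 2 = m1 + m2 ->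
  m1 * b1.*2 + m2 * b2.*2 = m1 + m2 ->
  m2 * a2 ^_ 3 + m2 * (b2.*2 * a2) = 2 * (m1 + m2) ->
  m1 * (c1 * 3) + m2 * (c2 * 3) + m2 * (b2.*2 * a2) = 2 * (m1 + m2) ->
  [/\ b1 = 0, c1 = 0 & m1 = m2] /\ [/\ a2 = 2, b2 = 1 & c2 = 0].
Proof.
move=> m1p m2p; rewrite ffact3 !ffactnSr ffactn0 mul1n subn0 => E1 E2 E3 E4 E5.
have a2E : a2 = 2.
  have : m2 * a2 * (a2 - 1) = m2 * a2 * 1 by rewrite -mulnA E2 muln1.
  by move/eqP; rewrite eqn_pmul2l; lia.
move: E1 E2 E3 E4 E5; rewrite {}a2E => E1 _ E3 E4 E5.
have m12 : m1 = m2 by lia.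
by move: E1 E3 E4 E5; rewrite {}m12 => E1 E3 E4 E5; split; split=> //; nia.
Qed.

(** The fixed-point counts [a1], [a2] have weighted mean 1. They cannot both be
    1, for then the weighted mean of a (a - 1) would be 0 instead of 1; so one
    of them is 0. *)
Lemma pattern_equations m1 m2 a1 a2 b1 b2 c1 c2 : 0 < m1 -> 0 < m2 ->
  [/\ m1 * a1 + m2 * a2 = m1 + m2,
      m1 * a1 ^_ 2 + m2 * a2 ^_ 2 = m1 + m2,
      m1 * b1.*2 + m2 * b2.*2 = m1 + m2,
      m1 * a1 ^_ 3 + m2 * a2 ^_ 3 + (m1 * (b1.*2 * a1) + m2 * (b2.*2 * a2))
        = 2 * (m1 + m2)
    & m1 * (c1 * 3) + m2 * (c2 * 3) + (m1 * (b1.*2 * a1) + m2 * (b2.*2 * a2))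
        = 2 * (m1 + m2)] <->
  ([/\ a1 = 0, b1 = 0 & c1 = 0] /\ [/\ a2 = 2, b2 = 1 & c2 = 0] /\ m1 = m2) \/
  ([/\ a2 = 0, b2 = 0 & c2 = 0] /\ [/\ a1 = 2, b1 = 1 & c1 = 0] /\ m2 = m1).
Proof.
move=> m1p m2p; split; last first.
  by case=> -[[-> -> ->] [[-> -> ->] ->]]; split=> //;
    rewrite ?(erefl : 2 ^_ 2 = 2) ?(erefl : 2 ^_ 3 = 0) ?ffact0n /=; lia.
case=> E1 E2 E3 E4 E5.
have [a10|a20] : a1 = 0 \/ a2 = 0.
- case: (ltngtP a1 1) => a1E; [lia| |].
  + by right; nia.
  by move: E1 E2; rewrite a1E !ffactnSr; nia.
- left; move: E1 E2 E4 E5; rewrite a10 ?muln0 ?add0n => E1 E2 E4 E5.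
  by have [[-> -> ->] ?] := pattern_equations_half m1p m2p E1 E2 E3 E4 E5.
right; move: E1 E2 E3 E4 E5.
rewrite a20 [RHS]addnC ?muln0 ?addn0 (addnC m1 m2) => E1 E2 E3 E4 E5.
rewrite addnC in E3; rewrite [X in X + _]addnC in E5.
by have [[-> -> ->] ?] := pattern_equations_half m2p m1p E1 E2 E3 E4 E5.
Qed.

Section Classes.
Variable gT : finGroupType.
Implicit Types (X : {set gT}) (x : gT).

Lemma class_memJ X x y : X \in classes [set: gT] ->
  ((x ^ y)%g \in X) = (x \in X).
Proof.
case/imsetP=> z _ ->.
by apply/class_eqP/class_eqP; rewrite (classGidl x (in_setT y)).
Qed.

Lemma classes_disjoint X1 X2 : X1 \in classes [set: gT] ->
  X2 \in classes [set: gT] -> X1 <> X2 -> [disjoint X1 & X2].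
Proof.
case/imsetP=> x _ -> /imsetP[y _ ->] xy; apply/pred0P=> z /=.
by apply/negP=> /andP[/class_eqP zx /class_eqP zy]; case: xy; rewrite -zx zy.
Qed.

Lemma sum_class X x (F : gT -> nat) : X \in classes [set: gT] -> x \in X ->
  (forall y z, F (y ^ z)%g = F y) -> \sum_(y in X) F y = #|X| * F x.
Proof.
case/imsetP=> z _ -> /class_eqP <- FJ; rewrite -sum_nat_const; apply: eq_bigr.
by move=> _ /imsetP[y _ ->].
Qed.

End Classes.

Theorem theorem3p7 (n : nat) (X1 X2 : {set 'S_n}) (x1 x2 : 'S_n) :
  5 <= n ->
  X1 \in classes [set: 'S_n] ->
  X2 \in classes [set: 'S_n] ->
  X1 <> X2 ->
  x1 \in X1 ->
  x2 \in X2 ->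
  (exists r : nat,
      0 < r /\
      is_factorization r (X1 :|: X2) (young_subgroup n [:: n - 3; 2; 1]))
  <->
  ([/\ num_fixed x1 = 0, num_cycles 2 x1 = 0 & num_cycles 3 x1 = 0] /\
   [/\ num_fixed x2 = 2, num_cycles 2 x2 = 1 & num_cycles 3 x2 = 0] /\
   #|X1| = #|X2|)
  \/
  ([/\ num_fixed x2 = 0, num_cycles 2 x2 = 0 & num_cycles 3 x2 = 0] /\
   [/\ num_fixed x1 = 2, num_cycles 2 x1 = 1 & num_cycles 3 x1 = 0] /\
   #|X2| = #|X1|).
Proof.
move=> n5 cX1 cX2 X12 x1X x2X.
have n3 : 3 <= n by lia.
have n4 : 4 <= #|'I_n| by rewrite card_ord ltnW.
have Xc : conj_closed (X1 :|: X2) by move=> x s; rewrite !inE !class_memJ.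
have dis := classes_disjoint cX1 cX2 X12.
have m1 : 0 < #|X1| by apply/card_gt0P; exists x1.
have m2 : 0 < #|X2| by apply/card_gt0P; exists x2.
have cardX : #|X1 :|: X2| = #|X1| + #|X2|.
  by rewrite cardsU (disjoint_setI0 dis) cards0 subn0.
have sumX k pi : (forall (sg : 'S_n) t, pi (map sg t) = map sg (pi t)) ->
    \sum_(x in X1 :|: X2) npattern k pi x
    = #|X1| * npattern k pi x1 + #|X2| * npattern k pi x2.
  move=> pim; rewrite (eq_bigl [predU X1 & X2]) ?bigU //=; last first.
    by move=> x; rewrite !inE.
  have patJ y z : npattern k pi (y ^ z)%g = npattern k pi y by apply: npattern_conj.
  by rewrite (sum_class cX1 x1X) // (sum_class cX2 x2X).
rewrite -pattern_equations //.
have -> : (exists r, 0 < r /\ is_factorization r (X1 :|: X2)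
    (young_subgroup n [:: n - 3; 2; 1])) <-> exists r, flag_uniform (X1 :|: X2) r.
  split=> -[r]; first by case=> _ /(factorization_flag_uniform _ n3 Xc); exists r.
  move=> Xr; exists r; split; last exact/factorization_flag_uniform.
  have := flag_uniform_card n4 Xr; rewrite cardX; case: r Xr => // _; lia.
rewrite flag_uniform_traces // cardX !sumX //.
all: try by move=> sg t; rewrite ?map_rev ?map_rot ?swap12_map.
by rewrite !npattern_id !npattern_rev !npattern_swap !npattern_rot !ffactn1.
Qed.
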